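(* Let $n$ be a positive integer. Define the polynomials in $q$ $$4d_{1,4}(n,q) = (q+1)\sum_{\substack{d \mid n \\ d \equiv 1 \pmod 4}} \left( q^{\left(\frac{2n}{d}+1\right)(d-1)/2} + q^{\left(\frac{2n}{d}-1\right)(d+1)/2} \right),$$ $$4d_{3,4}(n,q) = (q+1)\sum_{\substack{d \mid n \\ d \equiv 3 \pmod 4}} \left( q^{\left(\frac{2n}{d}+1\right)(d-1)/2} + q^{\left(\frac{2n}{d}-1\right)(d+1)/2} \right),$$ where the sums run over positive divisors $d$ of $n$. Then: (i) all the coefficients of $4d_{1,4}(n,q)$ and $4d_{3,4}(n,q)$ are non-negative integers; (ii) for every $k$, the monomial $q^k$ does not appear with non-zero coefficient in both $4d_{1,4}(n,q)$ and $4d_{3,4}(n,q)$; (iii) $r_2(n,q) = 4d_{1,4}(n,q) - 4d_{3,4}(n,q)$; (iv) evaluating at $q=1$, $4d_{1,4}(n,1) = 4d_{1,4}(n)$ and $4d_{3,4}(n,1) = 4d_{3,4}(n)$.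
   Context: For $n \geq 1$, $r_2(n,q)$ is defined as the coefficient of $t^n$ in the expansion, as a formal power series in $t$ with coefficients in $\mathbb{Z}[q,q^{-1}]$, $$\prod_{m=1}^{\infty} \frac{\left(1-(-qt)^m\right)^2}{\left(1+q(-qt)^m\right)\left(1+q^{-1}(-qt)^m\right)} = 1 + \sum_{n=1}^{\infty} r_2(n,q)\, t^n .$$ For integers $k,m$, $d_{k,m}(n)$ (with the single argument $n$) denotes the number of positive divisors of $n$ which are congruent to $k$ modulo $m$; thus $4d_{1,4}(n)$ and $4d_{3,4}(n)$ are four times such numbers. The symbols $4d_{1,4}(n,q)$ and $4d_{3,4}(n,q)$ (with two arguments) are to be read as single names for the polynomials defined in the statement. *)

(* Defs.v *)
From HB Require Import structures.
From mathcomp Require Import all_boot all_order all_algebra.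
From mathcomp Require Import boolp classical_sets.

Set Implicit Arguments.
Unset Strict Implicit.
Unset Printing Implicit Defensive.

Import Order.TTheory GRing.Theory Num.Theory.
Local Open Scope ring_scope.

(* Every commutative ring is a unit ring with classically chosen inverses; as
   in any unit ring, the inverse of a non-unit is that element itself. *)
Section ClassicalInverse.
Variable R : comNzRingType.

Definition cunit : pred R := fun x => `[< exists y, y * x = 1 >].
Definition cinv (x : R) : R := xget x [set y | y * x = 1]%classic.

Lemma cmulVr : {in cunit, left_inverse 1 cinv *%R}.
Proof. by move=> x /asboolP[y yx]; exact: (@xgetI _ x [set y | y * x = 1]%classic y yx). Qed.

Lemma cunitP (x y : R) : y * x = 1 -> cunit x.
Proof. by move=> yx; apply/asboolP; exists y. Qed.

Lemma cinv_out : {in [predC cunit], cinv =1 id}.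
Proof.
move=> x /negP Nx; rewrite /cinv xgetPN// => y /= yx.
by apply: Nx; exact: cunitP yx.
Qed.

End ClassicalInverse.

(* The ring Z[q, q^-1], as the subring of the field of fractions of Z[X]
   consisting of the p / X^k. *)
Definition laurent_pred : {pred {fraction {poly int}}} :=
  fun x => `[< exists (p : {poly int}) (k : nat),
                 x * tofrac ('X^k) = tofrac p >].

Lemma laurent_subring : subring_closed laurent_pred.
Proof.
split.
- by apply/asboolP; exists 1, 0%N; rewrite expr0 mul1r.
- move=> x y /asboolP[p [k xp]] /asboolP[r [l yr]]; apply/asboolP.
  exists (p * 'X^l - r * 'X^k), (k + l)%N.
  rewrite exprD tofracB !tofracM -xp -yr mulrBl.
  by congr (_ - _); rewrite -!mulrA; congr (_ * _); rewrite mulrC.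
- move=> x y /asboolP[p [k xp]] /asboolP[r [l yr]]; apply/asboolP.
  by exists (p * r), (k + l)%N; rewrite exprD !tofracM -xp -yr mulrACA.
Qed.

HB.instance Definition _ :=
  GRing.isSubringClosed.Build {fraction {poly int}} laurent_pred
    laurent_subring.

Record laurent := Laurent {
  laurent_val : {fraction {poly int}};
  _ : laurent_val \in laurent_pred }.

HB.instance Definition _ := [isSub for laurent_val].
HB.instance Definition _ := [Choice of laurent by <:].
HB.instance Definition _ := [SubChoice_isSubComNzRing of laurent by <:].
HB.instance Definition _ := GRing.ComNzRing_hasMulInverse.Build laurent
  (@cmulVr laurent) (@cunitP laurent) (@cinv_out laurent).

Fact laurent_q_subproof : tofrac 'X \in laurent_pred.
Proof. by apply/asboolP; exists 'X, 0%N; rewrite expr0 mulr1. Qed.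

Definition laurent_q : laurent := Laurent laurent_q_subproof.

Fact laurent_qV_subproof : (tofrac 'X)^-1 \in laurent_pred.
Proof.
by apply/asboolP; exists 1, 1%N; rewrite expr1 mulVf// tofrac_eq0 polyX_eq0.
Qed.

Lemma laurent_q_unit : laurent_q \is a GRing.unit.
Proof.
apply/asboolP; exists (Laurent laurent_qV_subproof).
by apply: val_inj; rewrite rmorphM rmorph1 /= mulVf// tofrac_eq0 polyX_eq0.
Qed.

Definition laurent_of_poly (p : {poly int}) : laurent :=
  (map_poly intr p).[laurent_q].

Lemma val_laurent_of_poly p : val (laurent_of_poly p) = tofrac p.
Proof.
rewrite /laurent_of_poly; elim/poly_ind: p => [|p c IHp].
  by rewrite !rmorph0 horner0 rmorph0.
rewrite rmorphD rmorphM /= map_polyX map_polyC hornerMXaddC.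
rewrite tofracD tofracM -IHp -[c in c%:P]intz [LHS](raddfD val) [X in X + _](rmorphM val).
by congr (_ + _); rewrite [RHS](rmorph_int (@tofrac _ \o polyC)) [LHS](rmorph_int val).
Qed.

Record fps (A : Type) := Fps { fcoef : nat -> A }.

Section FpsRing.
Variable A : comNzRingType.
Implicit Types p r s : fps A.

HB.instance Definition _ := gen_eqMixin (fps A).
HB.instance Definition _ := gen_choiceMixin (fps A).

Lemma fpsP p r : (forall n, fcoef p n = fcoef r n) <-> p = r.
Proof.
split=> [|->//]; case: p r => [f] [g] /= fg; congr Fps; exact/funext.
Qed.

Definition fps_zero : fps A := Fps (fun=> 0).
Definition fps_opp p : fps A := Fps (fun n => - fcoef p n).
Definition fps_add p r : fps A := Fps (fun n => fcoef p n + fcoef r n).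
Definition fps_one : fps A := Fps (fun n => (n == 0%N)%:R).
Definition fps_mul p r : fps A :=
  Fps (fun n => \sum_(i < n.+1) fcoef p i * fcoef r (n - i)).

Fact fps_addA : associative fps_add.
Proof. by move=> p r s; apply/fpsP => n /=; rewrite addrA. Qed.
Fact fps_addC : commutative fps_add.
Proof. by move=> p r; apply/fpsP => n /=; rewrite addrC. Qed.
Fact fps_add0 : left_id fps_zero fps_add.
Proof. by move=> p; apply/fpsP => n /=; rewrite add0r. Qed.
Fact fps_addN : left_inverse fps_zero fps_opp fps_add.
Proof. by move=> p; apply/fpsP => n /=; rewrite addNr. Qed.

HB.instance Definition _ :=
  GRing.isZmodule.Build (fps A) fps_addA fps_addC fps_add0 fps_addN.

Let trunc n p : {poly A} := \poly_(i < n) fcoef p i.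

Let truncE n p k : (k < n)%N -> (trunc n p)`_k = fcoef p k.
Proof. by move=> kn; rewrite coef_poly kn. Qed.

Let fps_mulE n p r k : (k < n)%N ->
  fcoef (fps_mul p r) k = (trunc n p * trunc n r)`_k.
Proof.
move=> kn; rewrite coefM; apply: eq_bigr => i _.
have ik : (i <= k)%N by rewrite -ltnS.
by rewrite !truncE// ?(leq_ltn_trans ik)// (leq_ltn_trans (leq_subr _ _)).
Qed.

Fact fps_mulC : commutative fps_mul.
Proof.
by move=> p r; apply/fpsP => n; rewrite !(@fps_mulE n.+1)// mulrC.
Qed.

Fact fps_mulA : associative fps_mul.
Proof.
move=> p r s; apply/fpsP => n.
transitivity ((trunc n.+1 p * trunc n.+1 r * trunc n.+1 s)`_n).
  rewrite -mulrA coefM; apply: eq_bigr => i _.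
  by rewrite truncE ?ltn_ord// (@fps_mulE n.+1)// ltnS leq_subr.
rewrite coefM; apply: eq_bigr => i _.
by rewrite [in RHS](@fps_mulE n.+1)// truncE// ltnS leq_subr.
Qed.

Fact fps_mul1 : left_id fps_one fps_mul.
Proof.
move=> p; apply/fpsP => n /=; rewrite big_ord_recl /= mul1r subn0 big1 ?addr0//.
by move=> i _; rewrite mul0r.
Qed.

Fact fps_mulDl : left_distributive fps_mul fps_add.
Proof.
move=> p r s; apply/fpsP => n /=; rewrite -big_split /=.
by apply: eq_bigr => i _; rewrite mulrDl.
Qed.

Fact fps_1neq0 : fps_one != 0.
Proof.
apply/eqP => /fpsP/(_ 0%N) /=; exact/eqP/oner_neq0.
Qed.

HB.instance Definition _ := GRing.Zmodule_isComNzRing.Build (fps A)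
  fps_mulA fps_mulC fps_mul1 fps_mulDl fps_1neq0.
HB.instance Definition _ := GRing.ComNzRing_hasMulInverse.Build (fps A)
  (@cmulVr (fps A)) (@cunitP (fps A)) (@cinv_out (fps A)).

Lemma fcoefD p r n : fcoef (p + r) n = fcoef p n + fcoef r n.
Proof. by []. Qed.
Lemma fcoefN p n : fcoef (- p) n = - fcoef p n.
Proof. by []. Qed.
Lemma fcoefM p r n :
  fcoef (p * r) n = \sum_(i < n.+1) fcoef p i * fcoef r (n - i).
Proof. by []. Qed.
Lemma fcoef1 n : fcoef (1 : fps A) n = (n == 0%N)%:R.
Proof. by []. Qed.

Definition fpsC (a : A) : fps A := Fps (fun n => a *+ (n == 0%N)).
Definition fpsX : fps A := Fps (fun n => (n == 1%N)%:R).

(* The infinite product over m >= 1, for the topology of coefficientwise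
   stabilization; the coefficients that do not stabilize are set to 0. *)
Definition stable_coef (F : nat -> fps A) (n : nat) (a : A) : Prop :=
  exists M, forall N, (M <= N)%N -> fcoef (\prod_(1 <= m < N.+1) F m) n = a.

Definition fps_infprod (F : nat -> fps A) : fps A :=
  Fps (fun n => xget 0 [set a | stable_coef F n a]%classic).

Definition fps_eqmod n p r := forall k, (k < n)%N -> fcoef p k = fcoef r k.

Lemma fps_eqmodM n p p' r r' : fps_eqmod n p p' -> fps_eqmod n r r' ->
  fps_eqmod n (p * r) (p' * r').
Proof.
move=> pp rr k kn; rewrite !fcoefM; apply: eq_bigr => i _.
have ik : (i <= k)%N by rewrite -ltnS.
by rewrite pp ?rr// ?(leq_ltn_trans ik)// (leq_ltn_trans (leq_subr _ _)).
Qed.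

Lemma fps_eqmodD n p p' r r' : fps_eqmod n p p' -> fps_eqmod n r r' ->
  fps_eqmod n (p + r) (p' + r').
Proof. by move=> pp rr k kn; rewrite !fcoefD pp// rr. Qed.

Lemma fps_eqmodN n p p' : fps_eqmod n p p' -> fps_eqmod n (- p) (- p').
Proof. by move=> pp k kn; rewrite !fcoefN pp. Qed.

Lemma fps_eqmodX0 p n : fcoef p 0 = 0 -> fps_eqmod n (p ^+ n) 0.
Proof.
move=> p0; elim: n => [//|n IHn] k kn; rewrite exprS fcoefM big1// => -[i /= ik] _.
case: i ik => [|i] ik; first by rewrite p0 mul0r.
rewrite IHn ?mulr0// ; case: k kn ik => // k; rewrite !ltnS => kn ik.
by rewrite subSS (leq_ltn_trans (leq_subr _ _)).
Qed.

Lemma fps_unit p : fcoef p 0 = 1 -> p \is a GRing.unit.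
Proof.
move=> p0; pose x := 1 - p.
have x0 : fcoef x 0 = 0 by rewrite fcoefD fcoefN p0 fcoef1 subrr.
have px : p = 1 - x by rewrite opprB addrC subrK.
pose g n : fps A := \sum_(i < n) x ^+ i.
have gE n k : (k < n)%N -> fcoef (g n) k = fcoef (g k.+1) k.
  elim: n => // n IHn; rewrite ltnS leq_eqVlt => /orP[/eqP->//|kn].
  by rewrite /g big_ord_recr fcoefD -/(g n) IHn// (fps_eqmodX0 x0)// addr0.
apply/asboolP; exists (Fps (fun n => fcoef (g n.+1) n)); apply/fpsP => n.
have -> : fcoef (Fps (fun n => fcoef (g n.+1) n) * p) n = fcoef (g n.+1 * p) n.
  by apply: (@fps_eqmodM n.+1) => // k kn /=; rewrite [RHS]gE.
rewrite mulrC px -[in LHS](expr1n _ n.+1) /g.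
have -> : (1 ^+ n.+1 - x) * (\sum_(i < n.+1) x ^+ i) = 1 - x ^+ n.+1.
  rewrite expr1n -opprB mulNr -subrX1 opprB //.
by rewrite fcoefD fcoefN (fps_eqmodX0 x0)// oppr0 addr0.
Qed.

Lemma stable_coef_uniq F n a b :
  stable_coef F n a -> stable_coef F n b -> a = b.
Proof.
move=> [M aM] [K bK].
by rewrite -(aM (maxn M K)) ?leq_maxl// -(bK (maxn M K)) ?leq_maxr.
Qed.

Lemma stable_coefP F n : (forall m, fps_eqmod m (F m) 1) ->
  forall N, (n <= N)%N -> fcoef (\prod_(1 <= m < N.+1) F m) n =
                          fcoef (fps_infprod F) n.
Proof.
move=> F1.
have st N : (n <= N)%N -> fcoef (\prod_(1 <= m < N.+1) F m) n =
                          fcoef (\prod_(1 <= m < n.+1) F m) n.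
  elim: N => [|N IHN]; first by rewrite leqn0 => /eqP->.
  rewrite leq_eqVlt => /orP[/eqP<-//|nN]; rewrite -IHN//.
  rewrite big_nat_recr//= -[RHS](congr1 (fun s : fps A => fcoef s n) (mulr1 _)).
  by apply: (@fps_eqmodM N.+1).
have stn : stable_coef F n (fcoef (\prod_(1 <= m < n.+1) F m) n) by exists n.
move=> N /st ->; apply: (stable_coef_uniq stn).
exact: (@xgetI _ 0 [set a | stable_coef F n a]%classic _ stn).
Qed.

End FpsRing.

Arguments fpsX {A}.

Definition r2_factor (m : nat) : fps laurent :=
  let q := fpsC laurent_q in
  let qV := fpsC (laurent_q^-1) in
  let u := - (q * fpsX) in
  (1 - u ^+ m) ^+ 2 / ((1 + q * u ^+ m) * (1 + qV * u ^+ m)).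

Definition r2 (n : nat) : laurent := fcoef (fps_infprod r2_factor) n.

Section R2Factor.
Let u : fps laurent := - (fpsC laurent_q * fpsX).
Let den m : fps laurent :=
  (1 + fpsC laurent_q * u ^+ m) * (1 + fpsC (laurent_q^-1) * u ^+ m).

Let u_eqmod m : fps_eqmod m (u ^+ m) 0.
Proof.
apply: fps_eqmodX0.
by rewrite fcoefN fcoefM big_ord_recl big_ord0 /= mulr0 addr0 oppr0.
Qed.

Let fac_eqmod m (a : fps laurent) : fps_eqmod m (1 + a * u ^+ m) 1.
Proof.
rewrite -[X in fps_eqmod _ _ X](addr0 1) -(mulr0 a).
by apply: fps_eqmodD => //; exact: fps_eqmodM.
Qed.

Let den_eqmod m : fps_eqmod m (den m) 1.
Proof. by rewrite -[X in fps_eqmod _ _ X](mulr1 1); exact: fps_eqmodM. Qed.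

Lemma r2_denominator_unit m : (0 < m)%N ->
  (1 + fpsC laurent_q * u ^+ m) * (1 + fpsC (laurent_q^-1) * u ^+ m)
    \is a GRing.unit.
Proof. by move=> m0; apply: fps_unit; rewrite (@den_eqmod m). Qed.

Lemma r2_factor_eqmod m : fps_eqmod m (r2_factor m) 1.
Proof.
case: m => [//|m]; have uD := @r2_denominator_unit m.+1 isT.
have uN : fps_eqmod m.+1 (1 - u ^+ m.+1) 1.
  by rewrite -[u ^+ _]mul1r -mulNr; exact: fac_eqmod.
rewrite -(divrr uD); apply: fps_eqmodM => //.
rewrite expr2 => k kn; rewrite (fps_eqmodM uN uN)// mulr1.
by rewrite (den_eqmod kn).
Qed.

(* The partial products do converge, so r2 n is their stable coefficient. *)
Lemma r2E n N : (n <= N)%N ->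
  fcoef (\prod_(1 <= m < N.+1) r2_factor m) n = r2 n.
Proof. by move=> nN; apply: stable_coefP nN => m; exact: r2_factor_eqmod. Qed.

Lemma r2_0 : r2 0 = 1.
Proof. by rewrite -(@r2E 0 0)// big_geq. Qed.

End R2Factor.

Definition ndiv (k m n : nat) : nat :=
  count (fun d => (d == k %[mod m])%N) (divisors n).

(* For d odd dividing n > 0, both halvings and both divisions are exact and the
   truncated subtractions are genuine ones. *)
Definition four_d4q (k n : nat) : {poly int} :=
  ('X + 1) * \sum_(d <- divisors n | (d == k %[mod 4])%N)
    ('X^(((2 * n %/ d + 1) * (d - 1) %/ 2)%N)
     + 'X^(((2 * n %/ d - 1) * (d + 1) %/ 2)%N)).

Definition four_d14q (n : nat) : {poly int} := four_d4q 1 n.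
Definition four_d34q (n : nat) : {poly int} := four_d4q 3 n.

(* Main.v *)
Require Import Defs.
From mathcomp Require Import all_boot all_order all_algebra.
From mathcomp Require Import ring zify.

(** The generating product is expanded in partial fractions.  Put [x = -qt],
    [w = (1 + q) (1 + q^-1)] and [D_n = (1 - x^n)^2 + x^n w], which factors as
    [(1 + q x^n) (1 + q^-1 x^n)].  The finite product then has the expansion
<<
      prod_(m <= N) (1 - x^m)^2 / D_m
        = 1 + w sum_(1 <= n <= N) (-1)^n x^(n(n+1)/2) (1 + x^n) a_(N,n) / D_n,
      a_(N,n) = (x)_N^2 / ((x)_(N-n) (x)_(N+n)),
>>
    proved by induction on [N] ([prod_quad]); the induction step comes down to
    the vanishing of an alternating sum of the [a_(N,n)], which telescopes
    ([qratio_partial_sum]).  As [N] grows, [a_(N,n)] tends to 1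
    ([prod_quad_eqmod]), and
<<
      w (1 + x^n) / D_n = (1 + q) (1 / (1 + q x^n) + q^-1 / (1 + q^-1 x^n)).
>>
    Expanding the two geometric series gives [r_2(n, q)] as [1 + q] times a
    signed sum over the pairs [(k, j)] with [k (k + 2j + 1) = 2n]
    ([fcoef_prod]).  Such a pair is a factorization of [2n] into factors of
    opposite parity, hence amounts to an odd divisor [d] of [n]: its odd factor
    ([sum_tri_pairs]).  The two monomials of the pair are those of [d] in
    [4d_(1,4)] or [4d_(3,4)], with sign [(-1)^((d-1)/2)] ([div_pair_exp]);
    this is the formula for [r_2].

    That no power of [q] is common to the two polynomials holds because no
    power of [q] is common to the contributions of two different odd divisors
    ([exp_mult_inj]).  With [e = 2n / d], the exponents of [d] are
    [n + (e - d + 1) / 2], [n + (e - d - 1) / 2] and their reflections in [n],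
    so a common exponent forces the gaps [|e - d|] to be equal or to differ
    by 2; but [m (m + D)] and [m' (m' + D + 2)] are never equal when they
    are positive. *)

Set Implicit Arguments.
Unset Strict Implicit.
Unset Printing Implicit Defensive.

Import GRing.Theory Num.Theory.
Local Open Scope ring_scope.

(** * The finite partial fraction expansion *)

Section FiniteExpansion.
Variables (R : comUnitRingType) (x w : R).

Definition qfact (N : nat) : R := \prod_(1 <= i < N.+1) (1 - x ^+ i).

(** The ratio of the Gaussian binomial coefficient [2N choose N + n] to the
    central one [2N choose N]. *)
Definition qratio (N n : nat) : R :=
  qfact N ^+ 2 / (qfact (N - n) * qfact (N + n)).

(** With [w = (1 - z) * (1 - z^-1)] this is [(1 - z x^n) * (1 - z^-1 x^n)]:
    the poles in [z] at [x^n] and [x^-n] merge into one simple pole in [w]. *)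
Definition quad (n : nat) : R := (1 - x ^+ n) ^+ 2 + x ^+ n * w.

Hypothesis one_subX_unit : forall n, (0 < n)%N -> 1 - x ^+ n \is a GRing.unit.
Hypothesis quad_unit : forall n, (0 < n)%N -> quad n \is a GRing.unit.

Lemma qfactS N : qfact N.+1 = qfact N * (1 - x ^+ N.+1).
Proof. by rewrite /qfact big_nat_recr. Qed.

Lemma qfact_unit N : qfact N \is a GRing.unit.
Proof.
elim: N => [|N IHN]; first by rewrite /qfact big_geq ?unitr1.
by rewrite qfactS unitrM IHN one_subX_unit.
Qed.

Lemma qratioK N n : qratio N n * (qfact (N - n) * qfact (N + n)) = qfact N ^+ 2.
Proof. by rewrite divrK// unitrM !qfact_unit. Qed.

Lemma qratio0 N : qratio N 0 = 1.
Proof. by rewrite /qratio subn0 addn0 -expr2 divrr// unitrX ?qfact_unit. Qed.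

Lemma qratioSr N n : (n < N)%N ->
  qratio N n.+1 * (1 - x ^+ (N + n.+1)) = qratio N n * (1 - x ^+ (N - n)).
Proof.
move=> nN; apply: (mulIr (qfact_unit (N - n.+1))).
apply: (mulIr (qfact_unit (N + n))).
have := qratioK N n.+1; have := qratioK N n.
have -> : (N - n = (N - n.+1).+1)%N by lia.
rewrite addnS !qfactS => <- /eqP; rewrite eq_sym => /eqP H.
by transitivity (qratio N n.+1 *
  (qfact (N - n.+1) * (qfact (N + n) * (1 - x ^+ (N + n).+1))));
  [ring | rewrite -H; ring].
Qed.

Lemma qratioSl N n : (n <= N)%N ->
  qratio N.+1 n * ((1 - x ^+ (N.+1 - n)) * (1 - x ^+ (N.+1 + n))) =
  (1 - x ^+ N.+1) ^+ 2 * qratio N n.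
Proof.
move=> nN; apply: (mulIr (qfact_unit (N - n))).
apply: (mulIr (qfact_unit (N + n))).
have := qratioK N.+1 n; rewrite subSn// addSn !qfactS => H.
transitivity (qratio N.+1 n * (qfact (N - n) * (1 - x ^+ (N - n).+1) *
  (qfact (N + n) * (1 - x ^+ (N + n).+1)))); first by ring.
by rewrite H exprMn -(qratioK N n); ring.
Qed.

(** A closed form for the partial sums, found by dividing them by
    [qratio N m] for small [N]; both sides then have the same increment in
    [m].  Its last factor [1 - x ^+ (N - m)] makes the full sum vanish. *)
Lemma qratio_partial_sum N m : (m <= N)%N ->
  (1 - x ^+ N) * (1 + \sum_(1 <= n < m.+1)
     (-1) ^+ n * x ^+ 'C(n, 2) * (1 + x ^+ n) * qratio N n) =
  (-1) ^+ m * x ^+ 'C(m.+1, 2) * qratio N m * (1 - x ^+ (N - m)).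
Proof.
elim: m => [_|m IHm mN].
  by rewrite big_geq// qratio0 subn0 bin_small//; ring.
rewrite big_nat_recr//= addrA mulrDr IHm 1?ltnW// (mulrAC _ (qratio N m)).
rewrite -mulrA (mulrC _ (qratio N m)) -qratioSr//.
rewrite (binS m.+1) bin1 addnC !exprD.
have -> : x ^+ N = x ^+ m.+1 * x ^+ (N - m.+1) by rewrite -exprD subnKC.
by rewrite !exprS; ring.
Qed.

(** This is the finite [q]-binomial theorem at a zero of the product, with the
    terms of index [n] and [-n] grouped together. *)
Lemma qratio_sum N : (0 < N)%N ->
  1 + \sum_(1 <= n < N.+1)
     (-1) ^+ n * x ^+ 'C(n, 2) * (1 + x ^+ n) * qratio N n = 0.
Proof.
move=> N0; apply: (mulrI (one_subX_unit N0)).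
by rewrite qratio_partial_sum// subnn subrr !mulr0.
Qed.

(** Partial fractions: it splits [1 / (quad N * quad n)] into multiples of
    [1 / quad N] and [1 / quad n]. *)
Lemma quad_diff N n : (n <= N)%N ->
  quad N - (1 - x ^+ (N - n)) * (1 - x ^+ (N + n)) = x ^+ (N - n) * quad n.
Proof.
move=> nN; rewrite /quad exprD.
have -> : x ^+ N = x ^+ n * x ^+ (N - n) by rewrite -exprD subnKC.
ring.
Qed.

(** The partial fraction expansion in [w] of the finite product.  Multiplying
    the expansion of order [N + 1] by [quad N.+1] gives [(1 - x^(N+1))^2] times
    that of order [N]: [qratioSl] and [quad_diff] match the terms with
    [n <= N], and what is left over is [w x^(N+1)] times the sum that
    [qratio_sum] shows to be zero. *)
Lemma prod_quad N :
  \prod_(1 <= m < N.+1) ((1 - x ^+ m) ^+ 2 / quad m) =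
  1 + w * \sum_(1 <= n < N.+1)
    (-1) ^+ n * x ^+ 'C(n.+1, 2) * (1 + x ^+ n) * qratio N n / quad n.
Proof.
elim: N => [|N IHN]; first by rewrite !big_geq// mulr0 addr0.
rewrite big_nat_recr//= IHN mulrA; apply: (mulIr (quad_unit (ltn0Sn N))).
rewrite divrK ?quad_unit// mulrC.
pose c n := (-1) ^+ n * x ^+ 'C(n, 2) * (1 + x ^+ n) * qratio N.+1 n.
have sumE : (\sum_(1 <= n < N.+2) (-1) ^+ n * x ^+ 'C(n.+1, 2) * (1 + x ^+ n) *
      qratio N.+1 n / quad n) * quad N.+1 =
    (1 - x ^+ N.+1) ^+ 2 * (\sum_(1 <= n < N.+1)
      (-1) ^+ n * x ^+ 'C(n.+1, 2) * (1 + x ^+ n) * qratio N n / quad n)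
    + x ^+ N.+1 * \sum_(1 <= n < N.+2) c n.
  rewrite [\sum_(1 <= n < N.+2) c n]big_nat_recr//= big_nat_recr//=.
  rewrite mulrDl (mulrDr _ (\sum_(1 <= n < N.+1) c n)) addrA.
  rewrite divrK ?quad_unit//; congr (_ + _); last first.
    by rewrite /c binS bin1 exprD; ring.
  rewrite mulr_suml !mulr_sumr -big_split/=; apply: eq_big_nat => n /andP[n0 nN].
  have qn := quad_unit n0; apply: (mulIr qn).
  rewrite mulrAC divrK// mulrDl.
  have -> e : (1 - x ^+ N.+1) ^+ 2 * (e * qratio N n / quad n) * quad n =
      e * ((1 - x ^+ N.+1) ^+ 2 * qratio N n).
    by rewrite mulrA divrK//; ring.
  rewrite -(qratioSl (n := n))//.
  have /eqP := quad_diff (ltnW nN); rewrite subr_eq => /eqP ->.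
  rewrite /c binS bin1 exprD.
  have -> : x ^+ N.+1 = x ^+ n * x ^+ (N.+1 - n) by rewrite -exprD subnKC// ltnW.
  ring.
have c0 : \sum_(1 <= n < N.+2) c n = -1.
  apply/eqP; rewrite eq_sym -subr_eq0 -opprD oppr_eq0.
  by apply/eqP; exact: qratio_sum.
move: sumE; rewrite c0; set S := (X in X * quad _ = _ -> _) => sumE.
transitivity (quad N.+1 + w * (S * quad N.+1)); last first.
  by rewrite [RHS]mulrDl mul1r -mulrA.
by rewrite sumE /quad; ring.
Qed.

End FiniteExpansion.

(** * Formal power series and the limit of the expansion *)

Lemma bin2_double k : ('C(k.+1, 2) * 2 = k * k.+1)%N.
Proof. by elim: k => [//|k IHk]; rewrite binS bin1 mulnDl IHk; lia. Qed.

Section PowerSeries.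
Variable A : comNzRingType.
Implicit Types (p r s : fps A) (a b : A).

Lemma fcoefCM a p n : fcoef (fpsC a * p) n = a * fcoef p n.
Proof.
rewrite fcoefM big_ord_recl /= mulr1n subn0 big1 ?addr0// => i _.
by rewrite mulr0n mul0r.
Qed.

Lemma fcoefXM p n : fcoef (fpsX * p) n.+1 = fcoef p n.
Proof.
rewrite fcoefM big_ord_recl big_ord_recl /= mul0r add0r mul1r big1 ?addr0//.
  by rewrite subSS subn0.
by move=> i _; rewrite mul0r.
Qed.

Lemma fcoefXM0 p : fcoef (fpsX * p) 0 = 0.
Proof. by rewrite fcoefM big_ord_recl big_ord0 /= mul0r addr0. Qed.

Lemma fpsCM a b : fpsC (a * b) = fpsC a * fpsC b.
Proof. by apply/fpsP => n; rewrite fcoefCM /= mulrnAr. Qed.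

Lemma fpsC1 : fpsC 1 = 1 :> fps A.
Proof. by apply/fpsP => n. Qed.

Lemma fpsCN a : fpsC (- a) = - fpsC a.
Proof. by apply/fpsP => n; rewrite fcoefN /= mulNrn. Qed.

Lemma fpsCX a n : fpsC (a ^+ n) = fpsC a ^+ n.
Proof. by elim: n => [|n IHn]; rewrite ?fpsC1// !exprS fpsCM IHn. Qed.

Lemma fcoef_CX_exp a m n : fcoef ((fpsC a * fpsX) ^+ m) n = a ^+ n *+ (n == m).
Proof.
elim: m n => [|m IHm] n.
  by rewrite expr0 fcoef1; case: n => // n; rewrite expr0.
rewrite exprS -mulrA fcoefCM; case: n => [|n]; first by rewrite fcoefXM0 mulr0.
by rewrite fcoefXM IHm exprS mulrnAr eqSS.
Qed.

Lemma fcoef_sum I (e : seq I) (P : pred I) (F : I -> fps A) n :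
  fcoef (\sum_(i <- e | P i) F i) n = \sum_(i <- e | P i) fcoef (F i) n.
Proof. by apply: (big_morph (fun p => fcoef p n)). Qed.

Lemma fps_eqmod_sum m n k (F G : nat -> fps A) :
  (forall i, (m <= i < n)%N -> fps_eqmod k (F i) (G i)) ->
  fps_eqmod k (\sum_(m <= i < n) F i) (\sum_(m <= i < n) G i).
Proof. by move=> FG j jk; rewrite !fcoef_sum; apply: eq_big_nat => i /FG ->. Qed.

Lemma fps_eqmod_mul0 k l p r :
  fps_eqmod k p 0 -> fps_eqmod l r 0 -> fps_eqmod (k + l) (p * r) 0.
Proof.
move=> p0 r0 n nkl; rewrite fcoefM big1// => -[i /= ik] _.
by case: (ltnP i k) => [/p0->|ki]; rewrite ?mul0r// r0 ?mulr0//; lia.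
Qed.

Lemma fps_eqmod_mul0l k p r : fps_eqmod k p 0 -> fps_eqmod k (r * p) 0.
Proof. by move=> p0; apply: (@fps_eqmod_mul0 0 k). Qed.

Lemma fps_eqmodW k l p r : (k <= l)%N -> fps_eqmod l p r -> fps_eqmod k p r.
Proof. by move=> kl pr n nk; apply: pr; apply: leq_trans kl. Qed.

Lemma fps_eqmod_sym k p r : fps_eqmod k p r -> fps_eqmod k r p.
Proof. by move=> pr n nk; rewrite pr. Qed.

Section Quad.
Variable (u w : fps A).
Hypothesis u0 : fcoef u 0 = 0.

Lemma one_addX_unit a n : (0 < n)%N -> 1 + fpsC a * u ^+ n \is a GRing.unit.
Proof.
move=> n0; apply: fps_unit.
by rewrite fcoefD fcoefCM (fps_eqmodX0 u0)// mulr0 addr0.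
Qed.

Lemma one_subX_unit n : (0 < n)%N -> 1 - u ^+ n \is a GRing.unit.
Proof.
by move=> n0; have := one_addX_unit (-1) n0; rewrite fpsCN fpsC1 mulN1r.
Qed.

Lemma qfact_eqmod M N : (M <= N)%N -> fps_eqmod M.+1 (qfact u N) (qfact u M).
Proof.
elim: N => [|N IHN]; first by rewrite leqn0 => /eqP->.
rewrite leq_eqVlt => /orP[/eqP->//|MN]; rewrite qfactS -[qfact u M]mulr1.
apply: fps_eqmodM; first exact: IHN.
rewrite -[X in fps_eqmod _ _ X]subr0; apply: fps_eqmodD => //; apply: fps_eqmodN.
exact: fps_eqmodW (fps_eqmodX0 u0).
Qed.

(** The two factors of the denominator agree with [qfact u N] up to order
    [N - n], so the quotient is [1] up to that order. *)
Lemma qratio_eqmod N n : (n <= N)%N -> fps_eqmod (N - n).+1 (qratio u N n) 1.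
Proof.
move=> nN; have qU := qfact_unit one_subX_unit.
have q2U : qfact u N ^+ 2 \is a GRing.unit by rewrite unitrX.
rewrite -(divrr q2U); apply: fps_eqmodM => //.
set d := _ * _; have dU : d \is a GRing.unit by rewrite unitrM !qU.
have dE : fps_eqmod (N - n).+1 d (qfact u N ^+ 2).
  apply: fps_eqmodM; first by apply: fps_eqmod_sym; apply: qfact_eqmod; lia.
  by apply: fps_eqmodW (qfact_eqmod _); lia.
rewrite -[d^-1](mulrK q2U) -[X in fps_eqmod _ _ X](mulKr dU) mulrA.
apply: fps_eqmodM => //; apply: fps_eqmodM => //; exact: fps_eqmod_sym.
Qed.

(** The limit of [prod_quad]: the error [qratio u N n - 1] starts in degree
    [N - n + 1], and the accompanying [u ^+ 'C(n.+1, 2)] starts in degree at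
    least [n], which together exceed [N]. *)
Lemma prod_quad_eqmod N :
  (forall n, (0 < n)%N -> quad u w n \is a GRing.unit) ->
  fps_eqmod N.+1 (\prod_(1 <= m < N.+1) ((1 - u ^+ m) ^+ 2 / quad u w m))
    (1 + w * \sum_(1 <= n < N.+1)
       (-1) ^+ n * u ^+ 'C(n.+1, 2) * (1 + u ^+ n) / quad u w n).
Proof.
move=> quadU; rewrite prod_quad//; last exact: one_subX_unit.
apply: fps_eqmodD => //; apply: fps_eqmodM => //.
apply: fps_eqmod_sum => n /andP[n0 nN].
apply: fps_eqmodM => //.
set c := (X in X * qratio _ _ _).
have -> : c * qratio u N n = c + c * (qratio u N n - 1) by ring.
rewrite -[X in fps_eqmod _ _ X]addr0; apply: fps_eqmodD => //.
rewrite /c -!mulrA mulrC -!mulrA; apply: (@fps_eqmodW _ (n + (N - n).+1)); first lia.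
apply: fps_eqmod_mul0.
  apply: fps_eqmodW (fps_eqmodX0 u0).
  by have := bin2_double n; nia.
apply: fps_eqmod_mul0l; rewrite mulrC; apply: fps_eqmod_mul0l.
rewrite -[X in fps_eqmod _ _ X](subrr 1).
by apply: fps_eqmodD => //; apply: qratio_eqmod.
Qed.

End Quad.

(** The geometric series cut after [n.+1] terms, since its remainder is
    divisible by the power [n.+1] of a series without constant term. *)
Lemma fcoef_geometric u a k t n : fcoef u 0 = 0 -> (0 < k)%N ->
  fcoef (u ^+ t / (1 + fpsC a * u ^+ k)) n =
  \sum_(j < n.+1) (- a) ^+ j * fcoef (u ^+ (t + k * j)) n.
Proof.
move=> u0 k0; have U := one_addX_unit u0 a k0.
set y := fpsC (- a) * u ^+ k.
have E : 1 + fpsC a * u ^+ k = 1 - y by rewrite /y fpsCN mulNr opprK.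
have -> : u ^+ t / (1 + fpsC a * u ^+ k) = \sum_(j < n.+1) u ^+ t * y ^+ j
    + u ^+ t * y ^+ n.+1 / (1 + fpsC a * u ^+ k).
  have S : (\sum_(j < n.+1) y ^+ j) * (1 - y) = 1 - y ^+ n.+1.
    by rewrite mulrC -[1 - y]opprB mulNr -subrX1 opprB.
  apply: (mulIr U); rewrite divrK// mulrDl divrK// E -mulr_sumr -mulrA S.
  by rewrite mulrBr mulr1 subrK.
rewrite fcoefD fcoef_sum.
have y0 : fcoef y 0 = 0 by rewrite fcoefCM (fps_eqmodX0 u0)// mulr0.
have -> : fcoef (u ^+ t * y ^+ n.+1 / (1 + fpsC a * u ^+ k)) n = 0.
  rewrite mulrAC (fps_eqmod_mul0l _ (@fps_eqmodX0 _ _ n.+1 y0))//.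
rewrite addr0; apply: eq_bigr => j _.
by rewrite /y exprMn -fpsCX mulrCA fcoefCM -exprM -exprD.
Qed.

End PowerSeries.

(** * The coefficients of the product *)

Section Coefficients.
Variables (A : comNzRingType) (q qV : A).
Hypothesis qqV : q * qV = 1.

Let u : fps A := - (fpsC q * fpsX).
Let w : fps A := (1 + fpsC q) * (1 + fpsC qV).

Let u0 : fcoef u 0 = 0.
Proof. by rewrite /u fcoefN fcoefCM mulr0 oppr0. Qed.

Let fcoef_uX m n : fcoef (u ^+ m) n = (- q) ^+ n *+ (n == m).
Proof. by rewrite /u -mulNr -fpsCN fcoef_CX_exp. Qed.

Lemma quad_factor n :
  quad u w n = (1 + fpsC q * u ^+ n) * (1 + fpsC qV * u ^+ n).
Proof.
have Q : fpsC q * fpsC qV = 1 by rewrite -fpsCM qqV fpsC1.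
by rewrite /quad /w; ring: Q.
Qed.

(** Splitting [quad u w k] back into its two factors: with [U = u ^+ k],
    [(1 + qV U) + qV (1 + q U) = (1 + qV) (1 + U)]. *)
Lemma quad_term k : (0 < k)%N ->
  w * ((-1) ^+ k * u ^+ 'C(k.+1, 2) * (1 + u ^+ k) / quad u w k) =
  fpsC ((1 + q) * (-1) ^+ k) *
    (u ^+ 'C(k.+1, 2) / (1 + fpsC q * u ^+ k)
     + fpsC qV * (u ^+ 'C(k.+1, 2) / (1 + fpsC qV * u ^+ k))).
Proof.
move=> k0; have Q : fpsC q * fpsC qV = 1 by rewrite -fpsCM qqV fpsC1.
have aU := one_addX_unit u0 q k0; have bU := one_addX_unit u0 qV k0.
have qC : fpsC (1 + q) = 1 + fpsC q.
  by apply/fpsP => i; rewrite fcoefD fcoef1 /= mulrnDl.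
rewrite quad_factor fpsCM fpsCX fpsCN fpsC1 qC invrM//.
apply: (mulIr aU); apply: (mulIr bU).
set a := 1 + fpsC q * _ in aU *; set b := 1 + fpsC qV * _ in bU *.
have aK : a^-1 * a = 1 by rewrite mulVr. have bK : b^-1 * b = 1 by rewrite mulVr.
set v := u ^+ 'C(_, _); set e := (-1) ^+ k.
transitivity (w * (e * v * (1 + u ^+ k)) * (a^-1 * a) * (b^-1 * b)).
  by ring.
transitivity ((1 + fpsC q) * e *
    (v * b * (a^-1 * a) + fpsC qV * v * a * (b^-1 * b))); last by ring.
by rewrite aK bK /w /a /b; ring: Q.
Qed.

(** Each geometric series contributes one monomial per pair [(k, j)]; the
    second one carries [qV ^+ j.+1], which the [q ^+ n] coming from [u]
    absorbs because [j < n] when ['C(k.+1, 2) + k * j = n] and [0 < k]. *)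
Lemma fcoef_prod n : (0 < n)%N ->
  fcoef (\prod_(1 <= m < n.+1) ((1 - u ^+ m) ^+ 2 /
    ((1 + fpsC q * u ^+ m) * (1 + fpsC qV * u ^+ m)))) n =
  (1 + q) * \sum_(1 <= k < n.+1) \sum_(j < n.+1 | ('C(k.+1, 2) + k * j == n)%N)
    (-1) ^+ (k + j + n) * (q ^+ (n + j) + q ^+ (n - j.+1)).
Proof.
move=> n0.
under eq_bigr => m _ do rewrite -quad_factor.
rewrite (prod_quad_eqmod u0)//; last first.
  by move=> m m0; rewrite quad_factor unitrM !one_addX_unit.
rewrite fcoefD fcoef1 (gtn_eqF n0) add0r !mulr_sumr fcoef_sum.
apply: eq_big_nat => k /andP[k0 kn]; rewrite quad_term// fcoefCM fcoefD fcoefCM.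
rewrite !fcoef_geometric// mulr_sumr -big_split/= -!mulrA; congr (_ * _).
rewrite mulr_sumr [RHS]big_mkcond/=; apply: eq_bigr => -[j /= jn] _.
rewrite !fcoef_uX [n == _]eq_sym.
case: eqP => [E|_]; last by rewrite !mulr0 addr0 mulr0.
have -> : n = (n - j.+1 + j.+1)%N by have := bin2_double k; nia.
set m := (n - j.+1)%N.
rewrite addnK !mulr1n.
have qX i : qV ^+ i * q ^+ i = 1 by rewrite -exprMn mulrC qqV expr1n.
rewrite [(- q) ^+ j]exprNn [(- qV) ^+ j]exprNn (exprNn q (m + j.+1)).
have -> : (-1) ^+ (k + j + (m + j.+1)) * (q ^+ (m + j.+1 + j) + q ^+ m) =
    (-1) ^+ (k + j + (m + j.+1)) *
    (q ^+ (m + j.+1 + j) + q ^+ m * (qV ^+ j.+1 * q ^+ j.+1)).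
  by rewrite qX mulr1.
by rewrite !exprD !exprS; ring.
Qed.

End Coefficients.

(** * Pairs and odd divisors *)

Section PairsDivisors.
Local Open Scope nat_scope.

(** The terms [u ^+ ('C(k.+1, 2) + k * j)] that contribute to degree [n].
    Doubling, these are the factorizations [k * (k + 2 j + 1)] of [2 n] whose
    factors have opposite parity, [k] being the smaller one. *)
Definition tri_pair (n k j : nat) : bool := (0 < k) && ('C(k.+1, 2) + k * j == n).

Lemma tri_pairE n k j :
  tri_pair n k j = (0 < k) && (k * (k + j.*2.+1) == n.*2).
Proof.
rewrite /tri_pair; congr (_ && _); have := bin2_double k.
by move=> H; apply/eqP/eqP; lia.
Qed.

(** The odd one of the two factors; it divides [n] because the other one takes
    the factor 2 of [2 n]. *)
Definition pair_div (k j : nat) : nat := if odd k then k else k + j.*2.+1.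

(** The inverse of [pair_div]: the cofactor of [d] in [2 n] is [e], and
    rounding down accounts for the [+ 1] in [|e - d| = 2 j + 1]. *)
Definition div_pair (n d : nat) : nat * nat :=
  let e := n.*2 %/ d in if d < e then (d, (e - d)./2) else (e, (d - e)./2).

Lemma pair_div_spec n k j : tri_pair n k j ->
  [/\ odd (pair_div k j), pair_div k j %| n & div_pair n (pair_div k j) = (k, j)].
Proof.
rewrite tri_pairE /pair_div /div_pair => /andP[k0 /eqP E].
case: ifP => [ko|ke].
  have cop : coprime k 2 by rewrite coprimen2.
  have dv : k %| n by rewrite -(Gauss_dvdl _ cop) muln2 -E dvdn_mulr.
  split=> //; rewrite -E mulKn//; case: ifP => [_|]; [congr pair; lia | lia].
have od : odd (k + j.*2.+1) by lia.
have cop : coprime (k + j.*2.+1) 2 by rewrite coprimen2.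
split=> //; first by rewrite -(Gauss_dvdl _ cop) muln2 -E dvdn_mull.
rewrite -E mulnK; last lia.
by case: ifP => [|_]; [lia | congr pair; lia].
Qed.

Lemma div_pair_spec n d : 0 < n -> odd d -> d %| n ->
  tri_pair n (div_pair n d).1 (div_pair n d).2 /\
  pair_div (div_pair n d).1 (div_pair n d).2 = d.
Proof.
move=> n0 od /dvdnP[c nE]; have d0 : 0 < d by lia.
have eE : n.*2 %/ d = c.*2 by rewrite nE doubleMl mulnK.
have c0 : 0 < c by case: c nE {eE} => //; lia.
rewrite tri_pairE /div_pair /pair_div eE; case: ifP => dc /=.
  split; last by rewrite od.
  rewrite d0 /=; apply/eqP.
  have -> : d + ((c.*2 - d)./2).*2.+1 = c.*2 by lia.
  by rewrite nE; lia.
rewrite odd_double double_gt0 c0 /=.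
have E : c.*2 + ((d - c.*2)./2).*2.+1 = d by lia.
by split=> //; rewrite E nE; apply/eqP; lia.
Qed.

Lemma tri_pair_ltn n k j : tri_pair n k j -> k < n.+1 /\ j < n.+1.
Proof. by rewrite tri_pairE => /andP[k0 /eqP E]; split; nia. Qed.

End PairsDivisors.

Lemma sum_divisors (V : nmodType) n (P : pred nat) (G : nat -> V) : (0 < n)%N ->
  \sum_(d <- divisors n | P d) G d = \sum_(d < n.+1 | P d && (d %| n)%N) G d.
Proof.
move=> n0.
rewrite -(big_mkord (fun d => P d && (d %| n)%N) G).
under [RHS]eq_bigl => d do rewrite andbC.
rewrite -big_filter_cond; apply: perm_big; apply: uniq_perm.
- exact: divisors_uniq.
- exact/filter_uniq/iota_uniq.
move=> d; rewrite mem_filter mem_index_iota -dvdn_divisors//=.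
by case: (boolP (d %| n)%N) => //= /(dvdn_leq n0); rewrite ltnS.
Qed.

Lemma sum_tri_pairs (V : nmodType) n (F : nat -> nat -> V) : (0 < n)%N ->
  \sum_(1 <= k < n.+1) \sum_(j < n.+1 | ('C(k.+1, 2) + k * j == n)%N) F k j =
  \sum_(d <- divisors n | odd d) F (div_pair n d).1 (div_pair n d).2.
Proof.
move=> n0; rewrite sum_divisors//.
transitivity (\sum_(p : 'I_n.+1 * 'I_n.+1 | tri_pair n p.1 p.2) F p.1 p.2).
  rewrite -(pair_big_dep (fun k : 'I_n.+1 => (0 < k)%N)
    (fun k j : 'I_n.+1 => ('C(k.+1, 2) + k * j == n)%N) (fun k j => F k j)) /=.
  rewrite -(big_mkord (fun k => (0 < k)%N)
    (fun k => \sum_(j < n.+1 | ('C(k.+1, 2) + k * j == n)%N) F k j)).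
  rewrite [RHS]big_mkcond [RHS]big_ltn//= add0r.
  by apply: eq_big_nat => k /andP[-> _].
(* By [tri_pair_ltn], [inord] does not truncate on the pairs that count. *)
pose h (d : 'I_n.+1) : 'I_n.+1 * 'I_n.+1 :=
  (inord (div_pair n d).1, inord (div_pair n d).2).
pose h' (p : 'I_n.+1 * 'I_n.+1) : 'I_n.+1 := inord (pair_div p.1 p.2).
have h'E (p : 'I_n.+1 * 'I_n.+1) :
    tri_pair n p.1 p.2 -> h' p = pair_div p.1 p.2 :> nat.
  by move=> /pair_div_spec[_ dv _]; rewrite inordK// ltnS dvdn_leq.
rewrite (reindex_onto h h') => [|[k j] Pkj].
  have hE (d : 'I_n.+1) : odd d -> (d %| n)%N ->
      (h d).1 = (div_pair n d).1 :> nat /\ (h d).2 = (div_pair n d).2 :> nat.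
    move=> od dn; have [/tri_pair_ltn[? ?] _] := div_pair_spec n0 od dn.
    by rewrite !inordK.
  have hP (d : 'I_n.+1) :
      tri_pair n (h d).1 (h d).2 && (h' (h d) == d) = odd d && (d %| n)%N.
    apply/idP/idP => [/andP[Pd /eqP <-]|/andP[od dn]].
      by rewrite h'E//; have [-> -> _] := pair_div_spec Pd.
    have [T D] := div_pair_spec n0 od dn; have [h1 h2] := hE d od dn.
    have Pd : tri_pair n (h d).1 (h d).2 by rewrite h1 h2.
    by rewrite Pd; apply/eqP/val_inj; rewrite /= h'E// h1 h2.
  rewrite (eq_bigl _ _ hP); apply: eq_bigr => d /andP[od dn].
  by have [-> ->] := hE d od dn.
have [_ _ dE] := pair_div_spec Pkj.
by rewrite /h h'E//= dE /= !inord_val.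
Qed.

(** * The exponents attached to a divisor *)

Section Exponents.
Local Open Scope nat_scope.

(** The two exponents attached to [d].  With [e = 2 n / d] they are
    [n - (e - d + 1) / 2] and [n + (e - d - 1) / 2], as [exp_pred_succE] records in
    a form free of division; which of them is smaller depends on [d]. *)
Definition exp_pred (n d : nat) : nat := (2 * n %/ d + 1) * (d - 1) %/ 2.
Definition exp_succ (n d : nat) : nat := (2 * n %/ d - 1) * (d + 1) %/ 2.

Lemma exp_pred_succE n d : 0 < n -> odd d -> d %| n -> exists c,
  [/\ 0 < c, n = c * d, n.*2 %/ d = c.*2,
      (exp_pred n d).*2 + c.*2.+1 = n.*2 + d &
      (exp_succ n d).*2 + d.+1 = n.*2 + c.*2].
Proof.
move=> n0 od /dvdnP[c nE]; have d0 : 0 < d by lia.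
have eE : n.*2 %/ d = c.*2 by rewrite nE doubleMl mulnK.
have c0 : 0 < c by case: c nE {eE} => //; lia.
exists c; rewrite /exp_pred /exp_succ mul2n eE.
have dE : d = d./2.*2.+1 by lia.
have -> : d - 1 = d./2 * 2 by lia.
have -> : d + 1 = d./2.+1 * 2 by lia.
rewrite !mulnA !mulnK// addn1 subn1.
have nE' : n = c + (c * d./2).*2 by rewrite nE {1}dE mulnS doubleMr.
split=> //; first by rewrite mulSn -doubleMl; lia.
case: c c0 nE' {nE eE} => // c _ ->.
by rewrite doubleS !mulSn mulnS -doubleMl; lia.
Qed.

(** The pair of [d] reproduces its two exponents, in an order that depends on
    whether [d] is the smaller factor of [2 n], and the sign is the nontrivial
    character modulo 4 of [d]. *)
Lemma div_pair_exp n d : 0 < n -> odd d -> d %| n ->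
  let kj := div_pair n d in
  odd (kj.1 + kj.2 + n) = odd d./2 /\
  ((n + kj.2, n - kj.2.+1) = (exp_pred n d, exp_succ n d) \/
   (n + kj.2, n - kj.2.+1) = (exp_succ n d, exp_pred n d)).
Proof.
move=> n0 od dn; have [c [c0 nE eE lE hE]] := exp_pred_succE n0 od dn.
have nE' : n = (c * d./2).*2 + c.
  by rewrite nE {1}(_ : d = d./2.*2.+1) ?mulnS -?muln2 ?mulnA; lia.
rewrite /div_pair eE; case: ifP => /= dc.
  by split; [lia | right; congr pair; lia].
by split; [lia | left; congr pair; lia].
Qed.

(** The coefficient of [q^i] in [(q + 1) (q^(exp_pred n d) + q^(exp_succ n d))]. *)
Definition exp_mult (n d i : nat) : nat :=
  (i == (exp_pred n d).+1) + (i == exp_pred n d)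
  + ((i == (exp_succ n d).+1) + (i == exp_succ n d)).

(** If [q^i] occurs for [d], then the gap [D = |e - d|] between the factors
    [d] and [e] of [2 n] is [|2 i - 2 n| + 1] or [|2 i - 2 n| - 1]. *)
Lemma exp_mult_gap n d i : 0 < n -> odd d -> d %| n -> exp_mult n d i != 0 ->
  exists m D, [/\ m * (m + D) = n.*2, d = m \/ d = m + D &
    [\/ i.*2.+1 = n.*2 + D, i.*2 = n.*2 + D + 1,
        i.*2 + D = n.*2.+1 | i.*2 + D + 1 = n.*2]].
Proof.
move=> n0 od dn H; have [c [c0 nE _ lE hE]] := exp_pred_succE n0 od dn.
have {}H : [\/ i = (exp_pred n d).+1, i = exp_pred n d,
             i = (exp_succ n d).+1 | i = exp_succ n d].
  move: H; rewrite /exp_mult.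
  by do 4 (case: (i =P _) => [->|_]; first by constructor).
have E : d * c.*2 = n.*2 by rewrite nE -!muln2; lia.
case: (leqP d c.*2) => dc.
  exists d, (c.*2 - d); rewrite subnKC//; split=> //; first by left.
  by case: H => {}H; [apply: Or43 | apply: Or44 | apply: Or42 | apply: Or41]; lia.
exists c.*2, (d - c.*2); rewrite subnKC 1?ltnW// mulnC; split=> //; first by right.
case: H => {}H; [apply: Or42 | apply: Or41 | apply: Or43 | apply: Or44]; lia.
Qed.

Lemma factor_gap_same N m m' D :
  m * (m + D) = N -> m' * (m' + D) = N -> m = m'.
Proof.
move=> E E'; case: (ltngtP m m') => // lt.
  have : m * (m + D) < m' * (m' + D) by rewrite ltn_mul// ltn_add2r.
  by rewrite E E' ltnn.
have : m' * (m' + D) < m * (m + D) by rewrite ltn_mul// ltn_add2r.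
by rewrite E E' ltnn.
Qed.

(** Raising the gap by 2 while lowering the smaller factor by at least 1
    strictly lowers the product: [(m - 1) (m + D + 1) < m (m + D)].  Not
    lowering the smaller factor strictly raises it. *)
Lemma factor_gap_apart N m m' D : 0 < N ->
  m * (m + D) = N -> m' * (m' + (D + 2)) <> N.
Proof.
move=> N0 E; case: (leqP m m') => lt.
  have m0 : 0 < m by case: m E {lt} => // E; rewrite -E in N0.
  have := leq_mul lt (leq_add lt (leqnn D)).
  by rewrite E addnA mulnDr => + E'; lia.
case: m E lt => [//|m] E; rewrite ltnS => lt E'.
have := leq_mul lt (leq_add lt (leqnn (D + 2))).
have -> : m + (D + 2) = (m.+1 + D).+1 by lia.
by rewrite E' -E mulSn (mulnS m (m.+1 + D)); lia.
Qed.

(** Two divisors that share an exponent have gaps that are equal or differ by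
    2.  The latter is excluded by [factor_gap_apart]; equal gaps give the same
    factorization of [2 n], in which only one factor is odd. *)
Lemma exp_mult_inj n d d' i : 0 < n -> odd d -> d %| n -> odd d' -> d' %| n ->
  exp_mult n d i != 0 -> exp_mult n d' i != 0 -> d = d'.
Proof.
move=> n0 od dn od' dn' H H'; have N0 : 0 < n.*2 by rewrite double_gt0.
have [m [D [E dE iE]]] := exp_mult_gap n0 od dn H.
have [m' [D' [E' dE' iE']]] := exp_mult_gap n0 od' dn' H'.
have DD : D' = D \/ D' = D + 2 \/ D = D' + 2.
  by clear -iE iE'; case: iE => iE; case: iE' => iE'; lia.
case: DD => [DD|[DD|DD]]; subst.
- have mm := factor_gap_same E E'; subst m'.
  have : ~~ odd (m * (m + D)) by rewrite E odd_double.
  rewrite oddM; case: dE dE' => dE [] dE'; rewrite dE in od *; rewrite dE' in od' *;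
    by rewrite ?od ?od'.
- by case: (factor_gap_apart N0 E E').
- by case: (factor_gap_apart N0 E' E).
Qed.

End Exponents.

(** * The polynomials and the theorem *)

Lemma coef_four_d4q k n i : (four_d4q k n)`_i =
  (\sum_(d <- divisors n | (d == k %[mod 4])%N) exp_mult n d i)%N%:R.
Proof.
rewrite /four_d4q mulr_sumr coef_sum natr_sum; apply: eq_bigr => d _.
rewrite -/(exp_pred n d) -/(exp_succ n d) mulrDr !mulrDl !mul1r -!exprS.
by rewrite !coefD !coefXn /exp_mult !natrD.
Qed.

Lemma four_d4q_ge0 k n i : 0 <= (four_d4q k n)`_i.
Proof. by rewrite coef_four_d4q ler0n. Qed.

Lemma four_d4q_neq0 k n i : (0 < n)%N -> (four_d4q k n)`_i <> 0 ->
  exists d, [/\ (d %| n)%N, (d == k %[mod 4])%N & exp_mult n d i != 0%N].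
Proof.
move=> n0; rewrite coef_four_d4q => nz.
case: (boolP (has (fun d => (d == k %[mod 4])%N && (exp_mult n d i != 0%N))
  (divisors n))) => [/hasP[d]|/hasPn none].
  by rewrite -dvdn_divisors// => dn /andP[dk di]; exists d.
case: nz; rewrite big_seq_cond big1// => d /andP[/none].
by rewrite negb_and => /orP[/negPf->//|/negPn/eqP].
Qed.

Lemma four_d4q_at1 k n : (four_d4q k n).[1] = (4 * ndiv k 4 n)%N%:Z.
Proof.
rewrite /four_d4q hornerM hornerD hornerX hornerC horner_sum.
under eq_bigr => d _ do rewrite hornerD !hornerXn !expr1n.
rewrite big_const_seq iter_addr_0 -/(ndiv k 4 n) -mulr_natr mulrA.
by rewrite -natz natrM.
Qed.

(** For odd [d] the sign [(-1) ^+ d./2] is [1] if [d] is 1 modulo 4 and [-1]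
    if [d] is 3 modulo 4. *)
Lemma r2_sum n : (0 < n)%N ->
  r2 n = (1 + laurent_q) * \sum_(d <- divisors n | odd d)
    (-1) ^+ d./2 * (laurent_q ^+ exp_pred n d + laurent_q ^+ exp_succ n d).
Proof.
move=> n0; rewrite -(@r2E n n)//.
have := @fcoef_prod laurent laurent_q laurent_q^-1 (divrr laurent_q_unit) n n0.
rewrite [LHS]/= => ->.
rewrite (sum_tri_pairs (fun k j => (-1) ^+ (k + j + n) *
  (laurent_q ^+ (n + j) + laurent_q ^+ (n - j.+1))) n0); congr (_ * _).
rewrite big_seq_cond [RHS]big_seq_cond; apply: eq_bigr => d /andP[].
rewrite -dvdn_divisors// => dn od.
have [sgn E] := div_pair_exp n0 od dn.
rewrite -signr_odd sgn signr_odd; congr (_ * _).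
by case: E => [[-> ->]|[-> ->]]; rewrite // addrC.
Qed.

Lemma laurent_of_four_d4q k n : laurent_of_poly (four_d4q k n) =
  (1 + laurent_q) * \sum_(d <- divisors n | (d == k %[mod 4])%N)
    (laurent_q ^+ exp_pred n d + laurent_q ^+ exp_succ n d).
Proof.
rewrite /laurent_of_poly /four_d4q rmorphM rmorphD rmorph1 /= map_polyX.
rewrite hornerM hornerD hornerX hornerC rmorph_sum horner_sum addrC.
congr (_ * _); apply: eq_bigr => d _.
by rewrite rmorphD /= !map_polyXn hornerD !hornerXn.
Qed.

Lemma r2_diff n : (0 < n)%N ->
  r2 n = laurent_of_poly (four_d14q n) - laurent_of_poly (four_d34q n).
Proof.
move=> n0; rewrite r2_sum// !laurent_of_four_d4q -mulrBr; congr (_ * _).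
rewrite (bigID (fun d => d == 1 %[mod 4])) /=; congr (_ + _).
  apply: eq_big => [d|d /andP[_ d1]]; first by lia.
  by rewrite -signr_odd (_ : odd d./2 = false) ?mul1r//; lia.
rewrite -sumrN; apply: eq_big => [d|d /andP[od d1]]; first by lia.
by rewrite -signr_odd (_ : odd d./2 = true) ?mulN1r//; lia.
Qed.

Theorem theorem1 (n : nat) (n_gt0 : (0 < n)%N) :
  [/\ (forall k : nat, 0 <= (four_d14q n)`_k /\ 0 <= (four_d34q n)`_k),
      (forall k : nat, ~ ((four_d14q n)`_k <> 0 /\ (four_d34q n)`_k <> 0)),
      r2 n = laurent_of_poly (four_d14q n) - laurent_of_poly (four_d34q n) &
      (four_d14q n).[1] = (4 * ndiv 1 4 n)%N%:Z /\
      (four_d34q n).[1] = (4 * ndiv 3 4 n)%N%:Z ].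
Proof.
split.
- by move=> k; split; exact: four_d4q_ge0.
- move=> i [/(four_d4q_neq0 n_gt0)[d [dn d1 di]]
    /(four_d4q_neq0 n_gt0)[d' [dn' d3 di']]].
  suff : d = d' by lia.
  by apply: (exp_mult_inj n_gt0 _ dn _ dn' di di'); lia.
- exact: r2_diff.
- by split; exact: four_d4q_at1.
Qed.
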